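(* Let $\{Y^f_\mu(t)\}_{t\ge0}$, $Y^f_\mu(t)=Y^f(G_\mu(t))$, be the geometric subordinated compound Poisson process with Bernstein function $f$, Poisson intensity $\lambda>0$, geometric parameter $\mu>0$ and jump distribution function $F$. Let $F^{(m)}$ denote the $m$-fold convolution of $F$ (the distribution function of the sum of $m$ i.i.d. jumps). Then for $y\in\mathbb{R}$ and $t>0$, $$\mathbb{P}[Y^f_\mu(t)\le y]=\frac{1}{1+\mu t(1-e^{-f(\lambda)})}\,\mathbb{I}_{\{y\ge0\}}+\sum_{m=1}^\infty\frac{(-1)^m}{m!}F^{(m)}(y)\,\frac{d^m}{du^m}\left(\frac{1}{1+\mu t(1-e^{-f(\lambda u)})}\right)\Bigg|_{u=1}.$$
   Context: $\{D^f(t)\}_{t\ge0}$ is a Lévy subordinator (non-decreasing Lévy process) with Laplace transform $\mathbb{E}[e^{-sD^f(t)}]=e^{-tf(s)}$, where $f(s)=bs+\int_0^\infty(1-e^{-sx})\,\nu(dx)$, $b\ge0$, is a Bernstein function, and $\nu$ is a Lévy measure on the positive half-line with $\int_0^\infty (x\wedge 1)\,\nu(dx)<\infty$ and infinite total mass. $\{N(t)\}_{t\ge0}$ is a homogeneous Poisson process with intensity $\lambda>0$, independent of $D^f$, and $N^f(t)=N(D^f(t))$ is the subordinated Poisson process. $X_1,X_2,\dots$ are i.i.d. random variables (jumps) with common distribution function $F$, independent of $N^f$. The generalized compound Poisson process is $Y^f(t)=\sum_{i=1}^{N^f(t)}X_i$ (empty sum $=0$). The geometric counting process $\{G_\mu(t)\}_{t\ge0}$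 with parameter $\mu>0$ is the mixed Poisson process whose random rate is exponentially distributed with mean $\mu$, so $\mathbb{P}[G_\mu(t)=k]=\frac{1}{1+\mu t}\left(\frac{\mu t}{1+\mu t}\right)^k$, $k=0,1,2,\dots$. The geometric subordinated compound Poisson process is $Y^f_\mu(t)=Y^f(G_\mu(t))$ with $G_\mu$ independent of $Y^f$. $\mathbb{I}$ denotes the indicator function. *)

(* Defs.v *)
From HB Require Import structures.
From mathcomp Require Import all_boot all_order all_algebra.
From mathcomp Require Import all_classical all_reals all_analysis.

Set Implicit Arguments.
Unset Strict Implicit.
Unset Printing Implicit Defensive.

Import Order.TTheory GRing.Theory Num.Theory.
Import numFieldNormedType.Exports.

Local Open Scope classical_set_scope.
Local Open Scope ring_scope.

(* Continuous-time processes are indexed by R; only times t >= 0 are ever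
   constrained or used.  Path properties are required on every path. *)

Section independence.
Context d (T : measurableType d) (R : realType) (P : probability T R).

Definition process_sigma I d' (U : measurableType d') (J : set I)
    (Z : I -> T -> U) : set (set T) :=
  <<s \bigcup_(i in J) preimage_set_system setT (Z i) measurable >>.

Definition independent_processes I1 d1 (U1 : measurableType d1) (J1 : set I1)
    (Z1 : I1 -> T -> U1) I2 d2 (U2 : measurableType d2) (J2 : set I2)
    (Z2 : I2 -> T -> U2) : Prop :=
  forall A B : set T, process_sigma J1 Z1 A -> process_sigma J2 Z2 B ->
    P (A `&` B) = (P A * P B)%E.

Definition mutually_independent (I : choiceType) d' (U : measurableType d')
    (Z : I -> T -> U) : Prop :=
  forall (s : seq I) (B : I -> set U), uniq s ->
    (forall i, i \in s -> measurable (B i)) ->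
    P [set w | forall i, i \in s -> B i (Z i w)] =
    (\prod_(i <- s) P (Z i @^-1` B i))%E.

End independence.

Section processes.
Context d (T : measurableType d) (R : realType) (P : probability T R).

Definition nonneg_times : set R := [set t | 0 <= t].

Definition independent_increments (Z : R -> T -> R) : Prop :=
  forall t : nat -> R, 0 <= t 0%N -> nondecreasing_seq t ->
    mutually_independent P (fun i w => Z (t i.+1) w - Z (t i) w).

Definition stationary_increments (Z : R -> T -> R) : Prop :=
  forall (s h : R) (B : set R), 0 <= s -> 0 <= h -> measurable B ->
    P [set w | B (Z (s + h) w - Z s w)] = P [set w | B (Z h w - Z 0 w)].

Definition cadlag_path (z : R -> R) : Prop :=
  (forall t, 0 <= t -> z u @[u --> t^'+] --> z t) /\
  (forall t, 0 < t -> cvg (z u @[u --> t^'-])).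

Record levy_process (Z : R -> T -> R) : Prop := LevyProcess {
  levy_start : forall w, Z 0 w = 0 ;
  levy_independent : independent_increments Z ;
  levy_stationary : stationary_increments Z ;
  levy_cadlag : forall w, cadlag_path (Z ^~ w) }.

Record levy_measure_pos (nu : {measure set R -> \bar R}) : Prop :=
  LevyMeasurePos {
  levy_measure_support : nu `]-oo, 0]%classic = 0%E ;
  levy_measure_small_jumps :
    (\int[nu]_(x in `]0%R, +oo[%classic) (Order.min x 1)%:E < +oo)%E }.

Definition bernstein (b : R) (nu : {measure set R -> \bar R}) (s : R) : R :=
  b * s + \int[nu]_(x in `]0, +oo[%classic) (1 - expR (- (s * x))).

Record levy_subordinator (f : R -> R) (D : R -> T -> R) : Prop :=
  LevySubordinator {
  subordinator_levy : levy_process D ;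
  subordinator_nondecreasing :
    forall w s t, 0 <= s -> s <= t -> D s w <= D t w ;
  subordinator_laplace : forall s t, 0 <= s -> 0 <= t ->
    ('E_P[fun w => expR (- (s * D t w))] = (expR (- (t * f s)))%:E)%E }.

Record counting_process (N : R -> T -> nat) : Prop := CountingProcess {
  counting_start : forall w, N 0 w = 0%N ;
  counting_nondecreasing :
    forall w s t, 0 <= s -> s <= t -> (N s w <= N t w)%N ;
  counting_cadlag : forall w, cadlag_path (fun t => (N t w)%:R) }.

(* The library's poisson_pmf is only meaningful for a positive rate, hence the
   strict inequalities between times here and in geometric_counting_process. *)
Record poisson_process (lambda : R) (N : R -> T -> nat) : Prop :=
  PoissonProcess {
  poisson_counting : counting_process N ;
  poisson_independent : independent_increments (fun t w => (N t w)%:R) ;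
  poisson_increments : forall (s t : R) (k : nat), 0 <= s -> s < t ->
    P [set w | N t w = (N s w + k)%N] =
    (poisson_pmf (lambda * (t - s)) k)%:E }.

(* Mixed Poisson process, described by its law: its finite-dimensional
   distributions are those of a Poisson process of rate l, averaged over l
   exponentially distributed with mean mu (i.e. with rate mu^-1). *)
Record geometric_counting_process (mu : R) (G : R -> T -> nat) : Prop :=
  GeometricCountingProcess {
  geometric_counting : counting_process G ;
  geometric_mixture : forall (n : nat) (t : nat -> R) (k : nat -> nat),
    0 <= t 0%N -> increasing_seq t ->
    P [set w | forall i, (i < n)%N -> G (t i.+1) w = (G (t i) w + k i)%N] =
    (\int[lebesgue_measure]_(l in `]0%R, +oo[%classic)
       (exponential_pdf mu^-1 l *
        \prod_(i < n) poisson_pmf (l * (t i.+1 - t i)) (k i))%:E)%E }.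

Definition subordinated (N : R -> T -> nat) (D : R -> T -> R) : R -> T -> nat :=
  fun t w => N (D t w) w.

Definition compound (N : R -> T -> nat) (X : nat -> T -> R) : R -> T -> R :=
  fun t w => \sum_(i < N t w) X i w.

Definition time_changed (Y : R -> T -> R) (G : R -> T -> nat) : R -> T -> R :=
  fun t w => Y (G t w)%:R w.

End processes.

Arguments nonneg_times {R}.

Section convolution.
Context {R : realType}.

(* (H * F)(y) = \int H(y - x) dF(x), a Lebesgue-Stieltjes integral. *)
Definition stieltjes_convolution (F : cumulative R R) (H : R -> R) (y : R) : R :=
  \int[lebesgue_stieltjes_measure F]_x H (y - x).

(* The 0-fold convolution is the distribution function of the constant 0. *)
Definition convolution_power (F : cumulative R R) (m : nat) : R -> R :=
  iter m (stieltjes_convolution F) (fun y => (0 <= y)%R%:R).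

End convolution.

(* Main.v *)
(* Conditionally on the clock [D k], the number of jumps [N (D k)] is Poisson of
   mean [lambda D k]. Mixing the laws of the [D k] with the weights
   [P (G t = k)] gives a probability [rho] on the half-line, and the total number
   of jumps is [m] with probability
     p_m = \int e^(- lambda z) (lambda z)^m / m! rho(dz).
   The generating function of [G t], evaluated at [e^(- f (lambda u))], is the
   function [g u] of the theorem, and it is also the Laplace transform of [rho]
   at [lambda u]. Expanding [e^(lambda z (1 - u))] under the integral gives
     g u = \sum_m p_m (1 - u)^m   for |1 - u| < 1,
   whence g^(m)(1) = (-1)^m m! p_m. It remains to condition on the number of
   jumps: given [m] jumps the process is at most [y] with probability F^(m)(y). *)
From HB Require Import structures.
Require Import Defs.
From mathcomp Require Import all_boot all_order all_algebra.
From mathcomp Require Import all_classical all_reals all_analysis.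
From mathcomp Require Import measurable_realfun ring lra.

Set Implicit Arguments.
Unset Strict Implicit.
Unset Printing Implicit Defensive.

Import Order.TTheory GRing.Theory Num.Theory.
Import numFieldNormedType.Exports.

Local Open Scope classical_set_scope.
Local Open Scope ring_scope.

(** Dominated convergence: on a finite measure the constant [k] is an integrable bound. *)
Lemma bounded_convergence d (T : measurableType d) (R : realType)
    (m : {finite_measure set T -> \bar R}) (D : set T) (h : (T -> R)^nat)
    (f : T -> R) (k : R) : measurable D ->
  (forall n, measurable_fun D (h n)) ->
  (forall x, D x -> h n x @[n --> \oo] --> f x) ->
  (forall n x, D x -> `|h n x| <= k) ->
  (\int[m]_(x in D) (h n x)%:E)%E @[n --> \oo] -->
  (\int[m]_(x in D) (f x)%:E)%E.
Proof.
move=> mD mh hf hk.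
have [| | | | |_ _] := @dominated_convergence _ _ R m D mD
  (fun n => EFin \o h n) (EFin \o f) (cst k%:E).
- by move=> n; exact/measurable_EFinP.
- by apply/measurable_EFinP; exact: measurable_fun_cvg mh hf.
- apply: aeW => x Dx; apply: cvg_EFin; [exact: nearW|exact: hf].
- exact: finite_measure_integrable_cst.
- by apply: aeW => x n Dx; rewrite lee_fin hk.
- exact.
Qed.

(** * Repeated differentiation of power series on the unit disc *)

Section power_series.
Context {R : realType}.
Implicit Types (c : R^nat) (g : R -> R).

(** Differentiation brings in a factor [n.+1], which is absorbed by enlarging the radius from [|x|]
    to some [r' < 1] where the series converges absolutely. *)
Lemma is_cvg_pseries_diffs c :
  (forall x, `|x| < 1 -> cvgn (pseries c x)) ->
  forall x, `|x| < 1 -> cvgn (pseries (pseries_diffs c) x).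
Proof.
move=> cc x; set r := `|x| => r1.
have r0 : 0 <= r by rewrite /r.
(* [r'] and [z] cut the interval from [r] to 1 into thirds: convergence at [z] gives absolute
   convergence at [r'], which dominates at [r]. *)
pose r' := (2 * r + 1) / 3; pose z := (r + 2) / 3.
have rr' : r < r' by rewrite /r'; lra.
have r'z : r' < z by rewrite /r' /z; lra.
have z1 : z < 1 by rewrite /z; lra.
have r'0 : 0 < r' by rewrite (le_lt_trans r0).
have z0 : 0 < z by rewrite (lt_trans r'0).
have nc : cvgn (pseries (fun i => `|c i|) r').
  by apply: (@is_cvg_pseries_inside_norm _ _ z); [apply: cc|];
    rewrite !gtr0_norm.
apply: normed_cvg.
(* [(n+1) r^n (r' - r) <= r'^(n+1) - r^(n+1)], by factoring the right side *)
have key n : n.+1%:R * r ^+ n <= r' ^+ n.+1 / (r' - r).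
  rewrite ler_pdivlMr ?subr_gt0// (@le_trans _ _ (r' ^+ n.+1 - r ^+ n.+1))//.
    rewrite subrXX mulrC ler_pM2l ?subr_gt0// -[in n.+1%:R](card_ord n.+1).
    rewrite -sum1_card natr_sum mulr_suml; apply: ler_sum => i _.
    rewrite mul1r -[X in r ^+ X](@subnK i n) ?leq_ord// exprD ler_wpM2r//.
      by rewrite exprn_ge0.
    by rewrite /= lerXn2r// ?nnegrE ltW.
  by rewrite gerBl exprn_ge0.
apply: (@series_le_cvg _ _ (fun n => (r' - r)^-1 * (`|c n.+1| * r' ^+ n.+1))).
- by move=> n /=.
- move=> n /=; rewrite !mulr_ge0// ?invr_ge0 ?subr_ge0 ?(ltW rr')// exprn_ge0//.
  exact: ltW.
- move=> n /=; rewrite /pseries_diffs !normrM normrX normr_nat -/r.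
  rewrite mulrAC [leRHS]mulrCA [_^-1 * _]mulrC [leRHS]mulrC.
  by rewrite ler_wpM2r.
- apply: is_cvg_seriesZ => /=.
  rewrite (_ : series _ = fun n =>
      \sum_(1 <= k < n.+1) `|c k| * r' ^+ k); last first.
    by apply/funext => n; rewrite /series/= big_add1.
  have := nc; rewrite /pseries -(@is_cvg_series_restrict 1%N) /= => /cvg_ex[l].
  by rewrite -cvg_shiftS => /cvgP.
Qed.

Lemma is_cvg_iter_pseries_diffs c n :
  (forall x, `|x| < 1 -> cvgn (pseries c x)) ->
  forall x, `|x| < 1 -> cvgn (pseries (iter n (@pseries_diffs R) c) x).
Proof. by move=> cc; elim: n => [//|n ih] x x1; exact: is_cvg_pseries_diffs. Qed.

(** The [n]-th formal derivative has coefficients [c (i + n) * (i + n)! / i!], here with the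
    denominator cleared. At [i = 0] this gives [n! * c n]. *)
Lemma iter_pseries_diffsE c n i :
  iter n (@pseries_diffs R) c i * i`!%:R = (i + n)`!%:R * c (i + n)%N.
Proof.
elim: n i => [i|n ih i]; first by rewrite addn0 mulrC.
by rewrite iterS /pseries_diffs mulrAC -natrM -factS mulrC ih addSnnS.
Qed.

Lemma pseries0 c : limn (pseries c 0) = c 0%N.
Proof.
apply: cvg_lim => //; rewrite -cvg_shiftS/=; apply: cvg_near_cst; near=> n.
rewrite /pseries/series/= big_nat_recl//= big1 ?addr0 ?mulr1//.
by move=> i _; rewrite expr0n mulr0.
Unshelve. all: by end_near. Qed.

(** Induction on [n], over the whole disc, because the next derivative depends on values near [u].
    The chain rule for [1 - u] contributes one factor -1 per derivative. *)
Lemma derive1n_pseries c g n :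
  (forall x, `|x| < 1 -> cvgn (pseries c x)) ->
  (forall u, `|1 - u| < 1 -> g u = limn (pseries c (1 - u))) ->
  forall u : R, `|1 - u| < 1 ->
    derive1n n g u =
      (-1) ^+ n * limn (pseries (iter n (@pseries_diffs R) c) (1 - u))
    /\ derivable (derive1n n g) u 1.
Proof.
move=> cc gE.
have dE (u : R) (h : R -> R) k : `|1 - u| < 1 ->
    (forall v, `|1 - v| < 1 ->
      h v = (-1) ^+ k * limn (pseries (iter k (@pseries_diffs R) c) (1 - v))) ->
    is_derive u (1 : R) h
      ((-1) ^+ k.+1 * limn (pseries (iter k.+1 (@pseries_diffs R) c) (1 - u))).
  move=> u1 hE.
  have nearu : \forall v \near u, `|1 - v| < 1.
    have : (fun v : R => `|1 - v|) x @[x --> u] --> `|1 - u|.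
      by apply: cvg_norm; apply: cvgB => //; exact: cvg_cst.
    by move/cvgr_lt; exact.
  (* Differentiating under the sum needs a radius beyond [|1 - u|] at which the series and its first
     two formal derivatives converge; the midpoint to 1 serves. *)
  pose K := (`|1 - u| + 1) / 2.
  have K0 : 0 < K by rewrite divr_gt0// ltr_wpDl.
  have uK : `|1 - u| < `|K| by rewrite (gtr0_norm K0) /K; lra.
  have K1 : `|K| < 1 by rewrite (gtr0_norm K0) /K; lra.
  have /= := @pseries_snd_diffs _ (iter k (@pseries_diffs R) c) K (1 - u)
    (is_cvg_iter_pseries_diffs cc K1)
    (is_cvg_iter_pseries_diffs (n := k.+1) cc K1)
    (is_cvg_iter_pseries_diffs (n := k.+2) cc K1) uK.
  set L : R -> R := fun x => limn (pseries _ x).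
  move=> dL.
  have dB : is_derive u (1 : R) (fun v : R => 1 - v) (0 - 1).
    exact: (@is_deriveB _ _ _ (cst (1 : R)) id u 1 0 1).
  have dC := @is_derive1_comp R L _ u _ _ dL dB.
  have := @is_deriveZ _ _ _ _ ((-1) ^+ k) _ _ _ dC.
  rewrite sub0r mulrN1 scalerN => {}dC.
  apply: near_eq_is_derive; last first.
    by apply: (is_derive_eq dC); rewrite exprS mulN1r mulNr.
  by near=> v; rewrite hE//; near: v.
elim: n => [|n ih] u u1.
  have dg := dE u g 0%N u1 (fun v v1 => etrans (gE v v1) (esym (mul1r _))).
  by split; [rewrite /= gE// mul1r|exact: ex_derive].
have dn := dE u _ n u1 (fun v v1 => (ih v v1).1).
have hn v : `|1 - v| < 1 -> derive1n n.+1 g v =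
    (-1) ^+ n.+1 * limn (pseries (iter n.+1 (@pseries_diffs R) c) (1 - v)).
  move=> v1; rewrite derive1nS derive1E.
  by have [_ ->] := dE v _ n v1 (fun v v1 => (ih v v1).1).
by split; [exact: hn|have [] := dE u _ n.+1 u1 hn].
Unshelve. all: by end_near. Qed.
End power_series.

(** * Poisson weights and their generating function *)

Section poisson_weight.
Context {R : realType}.
Implicit Types x s : R.

(* Unlike [poisson_pmf], this is the point mass at 0 when the rate is 0. *)
Definition poisson_weight (x : R) (m : nat) : R := x ^+ m / m`!%:R * expR (- x).

Lemma poisson_pmfE x m : 0 < x -> poisson_pmf x m = poisson_weight x m.
Proof. by move=> x0; rewrite /poisson_pmf x0. Qed.

Lemma poisson_weight_ge0 x m : 0 <= x -> 0 <= poisson_weight x m.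
Proof. by move=> x0; rewrite !mulr_ge0// ?exprn_ge0 ?invr_ge0 ?expR_ge0. Qed.

Lemma continuous_poisson_weight m : continuous (poisson_weight ^~ m).
Proof.
move=> x; rewrite /poisson_weight; apply: cvgM; last first.
  by apply: continuous_comp; [exact: cvgN|exact: continuous_expR].
by apply: cvgM; [exact: exprn_continuous|exact: cvg_cst].
Qed.

Lemma measurable_poisson_weight m :
  measurable_fun [set: R] (poisson_weight ^~ m).
Proof.
by apply: continuous_measurable_fun; exact: continuous_poisson_weight.
Qed.

(** The exponential series of [x * s], multiplied by [e^(-x)]. *)
Lemma poisson_weight_pgf x s :
  series (fun m => poisson_weight x m * s ^+ m) @ \oo -->
  expR (- (x * (1 - s))).
Proof.
rewrite mulrBr mulr1 opprB addrC expRD.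
rewrite (_ : series _ = fun n => expR (- x) * series (exp_coeff (x * s)) n).
  by apply: cvgMl_tmp; exact: is_cvg_series_exp_coeff.
apply/funext => n; rewrite /series/= mulr_sumr; apply: eq_bigr => i _.
by rewrite /poisson_weight /exp_coeff/= exprMn; ring.
Qed.

(** At [s = 1] the generating function is 1, and the partial sums increase to it. *)
Lemma sum_poisson_weight_le1 x n : 0 <= x ->
  \sum_(0 <= m < n) poisson_weight x m <= 1.
Proof.
move=> x0; have := @poisson_weight_pgf x 1.
rewrite subrr mulr0 oppr0 expR0.
rewrite (_ : series _ = series (poisson_weight x)); last first.
  by congr series; apply/funext => m; rewrite expr1n mulr1.
move=> h; rewrite -(cvg_lim _ h)//.
apply: nondecreasing_cvgn_le => //; last by apply/cvg_ex; exists 1.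
by apply: nondecreasing_series => m _ _; exact: poisson_weight_ge0.
Qed.

Lemma poisson_weight_le1 x m : 0 <= x -> poisson_weight x m <= 1.
Proof.
move=> x0; apply: le_trans (@sum_poisson_weight_le1 x m.+1 x0).
rewrite big_nat_recr//= lerDr; apply: sumr_ge0 => i _.
exact: poisson_weight_ge0.
Qed.

Lemma nneseries_poisson_weight x s : 0 <= x -> 0 <= s ->
  (\sum_(m <oo) (poisson_weight x m * s ^+ m)%:E =
   (expR (- (x * (1 - s))))%:E)%E.
Proof.
move=> x0 s0; apply/cvg_lim => //.
under eq_fun do rewrite sumEFin.
by apply: cvg_EFin; [exact: nearW|exact: poisson_weight_pgf].
Qed.

End poisson_weight.

(** * Expansion of a Laplace transform in mixed Poisson weights *)

Section laplace_power_series.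
Context {R : realType}.
Variable rho : {finite_measure set R -> \bar R}.
Local Notation I := (`[0%R, +oo[%classic : set R).

Lemma integrable_bounded (h : R -> R) (k : R) : measurable_fun [set: R] h ->
  (forall z, 0 <= z -> `|h z| <= k) -> rho.-integrable I (EFin \o h).
Proof.
move=> mh hk; apply: (@le_integrable _ _ _ _ _ _ _ (cst k%:E)) => //.
- exact/measurable_EFinP/measurable_funTS.
- move=> z /=; rewrite in_itv/= andbT => z0; rewrite lee_fin.
  exact: le_trans (hk _ z0) (ler_norm _).
- exact: finite_measure_integrable_cst.
Qed.

(** For [|s| <= 1] the partial sums of the Poisson generating function are bounded by the total
    weight, hence by 1, so bounded convergence exchanges sum and integral. *)
Lemma laplace_pseries (lambda s : R) : 0 <= lambda -> `|s| <= 1 ->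
  pseries (fun m => \int[rho]_(z in I) poisson_weight (lambda * z) m) s @ \oo -->
  \int[rho]_(z in I) expR (- (lambda * z * (1 - s))).
Proof.
move=> l0 s1; rewrite /pseries.
have mw m : measurable_fun [set: R] (fun z => poisson_weight (lambda * z) m).
  apply: (measurableT_comp (measurable_poisson_weight m)).
  exact: measurable_funM.
have iw m : rho.-integrable I (EFin \o (fun z => poisson_weight (lambda * z) m)).
  apply: (@integrable_bounded _ 1) => // z z0.
  by rewrite ger0_norm ?poisson_weight_le1 ?poisson_weight_ge0// mulr_ge0.
pose h n z := \sum_(0 <= m < n) poisson_weight (lambda * z) m * s ^+ m.
have mh n : measurable_fun [set: R] (h n).
  by apply: measurable_sum => m; exact: measurable_funM.
have hle n z : 0 <= z -> `|h n z| <= 1.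
  move=> z0; have lz0 : 0 <= lambda * z by rewrite mulr_ge0.
  apply: le_trans (@sum_poisson_weight_le1 _ (lambda * z) n lz0).
  apply: le_trans (ler_norm_sum _ _ _) _; apply: ler_sum => m _.
  by rewrite normrM ger0_norm ?poisson_weight_ge0// ler_piMr
    ?poisson_weight_ge0// normrX exprn_ile1.
rewrite (_ : series _ = fun n => \int[rho]_(z in I) h n z); last first.
  apply/funext => n; elim: n => [|n ih].
    rewrite /series/= big_geq// (_ : h 0%N = cst 0).
      by rewrite Rintegral_cst ?mul0r.
    by apply/funext => z; rewrite /h big_geq.
  rewrite seriesSr ih /= -RintegralZr// -RintegralD//.
  - by apply: eq_Rintegral => z _; rewrite /h big_nat_recr.
  - exact: integrable_bounded (mh n) (hle n).
  - apply: (@integrable_bounded _ 1); first exact: measurable_funM.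
    move=> z z0; have lz0 : 0 <= lambda * z by rewrite mulr_ge0.
    rewrite normrM normrX ger0_norm ?poisson_weight_ge0//.
    by rewrite mulr_ile1 ?poisson_weight_ge0 ?poisson_weight_le1 ?exprn_ile1
      ?exprn_ge0.
have iexp : rho.-integrable I
    (EFin \o (fun z => expR (- (lambda * z * (1 - s))))).
  apply: (@integrable_bounded _ 1) => [|z z0].
    apply: measurableT_comp => //; apply: measurable_funN.
    by apply: measurable_funM => //; exact: measurable_funM.
  rewrite ger0_norm ?expR_ge0// -[leRHS]expR0 ler_expR oppr_le0 !mulr_ge0//.
  by rewrite subr_ge0; exact: le_trans (ler_norm _) s1.
apply: fine_cvg; rewrite fineK; last exact: (integrable_fin_num _ iexp).
apply: (@bounded_convergence _ _ _ rho I h _ 1) => //.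
- by move=> n; exact: measurable_funTS.
- by move=> z _; exact: poisson_weight_pgf.
- by move=> n z; rewrite /= in_itv/= andbT; exact: hle.
Qed.
End laplace_power_series.

(** * Generating function of the geometric counting process *)

Section geometric_law.
Context d (T : measurableType d) (R : realType) (P : probability T R).
Local Notation leb := (@lebesgue_measure R).

(** The density vanishes on negative reals and the endpoint 0 is negligible, so the integral over
    the whole line is recovered. *)
Lemma integral_exponential_pdf_gt0 (a : R) : 0 < a ->
  (\int[leb]_(l in `]0%R, +oo[%classic) (exponential_pdf a l)%:E = 1)%E.
Proof.
move=> a0; have mpdf D : measurable_fun D (EFin \o exponential_pdf a).
  by apply/measurable_EFinP/measurable_funTS; exact: measurable_exponential_pdf.
rewrite integral_itv_obnd_cbnd//.
rewrite -[RHS](integral_exponential_pdf a0) integral_mkcond.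
apply: eq_integral => l _.
rewrite patchE; case: ifPn => // l0; rewrite lt0_exponential_pdf//.
by move: l0; rewrite notin_setE/= in_itv/= andbT => /negP; rewrite -ltNge.
Qed.

Lemma geometric_mixture_time (mu : R) (G : R -> T -> nat) (t : R) (k : nat) :
  geometric_counting_process P mu G -> 0 < t ->
  P [set w | G t w = k] = (\int[leb]_(l in `]0%R, +oo[%classic)
    (exponential_pdf mu^-1 l * poisson_weight (l * t) k)%:E)%E.
Proof.
move=> [[G0 _ _] Gmix] t0.
(* With [n = 1] only the increment from time 0 to time [t] is constrained; the remaining times just
   keep the sequence increasing. *)
have := Gmix 1%N (fun i => t * i%:R) (fun=> k).
rewrite mulr0 lexx => /(_ isT) h.
rewrite (_ : [set w | G t w = k] = [set w | forall i, (i < 1)%N ->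
  G (t * i.+1%:R)%R w = (G (t * i%:R)%R w + k)%N]); last first.
  apply/seteqP; split => w /=.
    by move=> Gk i; rewrite ltnS leqn0 => /eqP ->; rewrite mulr1 mulr0 G0.
  by move/(_ 0%N isT); rewrite mulr1 mulr0 G0.
rewrite h; last by apply/increasing_seqP => n; rewrite ltr_pM2l// ltr_nat.
apply: eq_integral => l; rewrite inE/= in_itv/= andbT => l0.
by rewrite big_ord1 mulr1 mulr0 subr0 poisson_pmfE// mulr_gt0.
Qed.

(** Tonelli moves the sum inside the average over the rate [l], where the Poisson generating
    function equals [e^(- l t (1 - q))]; an elementary exponential integral remains. *)
Lemma geometric_pgf (mu : R) (G : R -> T -> nat) (t q : R) :
  geometric_counting_process P mu G -> 0 < mu -> 0 < t -> 0 <= q <= 1 ->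
  (\sum_(k <oo) P [set w | G t w = k] * (q ^+ k)%:E =
    ((1 + mu * t * (1 - q))^-1)%:E)%E.
Proof.
move=> GG mu0 t0 /andP[q0 q1].
have mf k : measurable_fun (`]0, +oo[%classic : set R) (fun l : R =>
    (exponential_pdf mu^-1 l * poisson_weight (l * t) k * q ^+ k)%:E).
  apply/measurable_EFinP/measurable_funTS; apply: measurable_funM => //.
  apply: measurable_funM; first exact: measurable_exponential_pdf.
  apply: (measurableT_comp (measurable_poisson_weight k)).
  exact: measurable_funM.
have f0 k (l : R) : 0 < l ->
    0 <= exponential_pdf mu^-1 l * poisson_weight (l * t) k.
  move=> l0; apply: mulr_ge0.
    by apply: exponential_pdf_ge0; rewrite invr_ge0 ltW.
  by rewrite poisson_weight_ge0// mulr_ge0// ltW.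
(* The density of rate [mu^-1] times [e^(- l t (1 - q))] is [mu^-1 / b] times the density of rate
   [b], so the answer is [mu^-1 / b]. *)
pose b := mu^-1 + t * (1 - q).
have b0 : 0 < b by rewrite ltr_pwDl ?invr_gt0// mulr_ge0 ?subr_ge0// ltW.
transitivity (\sum_(k <oo) \int[leb]_(l in `]0%R, +oo[%classic)
    (exponential_pdf mu^-1 l * poisson_weight (l * t) k * q ^+ k)%:E)%E.
  apply: eq_eseriesr => k _; rewrite (geometric_mixture_time k GG t0).
  rewrite -ge0_integralZr//=; last 3 first.
  - apply/measurable_EFinP/measurable_funTS.
    apply: measurable_funM; first exact: measurable_exponential_pdf.
    apply: (measurableT_comp (measurable_poisson_weight k)).
    exact: measurable_funM.
  - by move=> l; rewrite in_itv/= andbT => l0; rewrite lee_fin f0.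
  - by rewrite lee_fin exprn_ge0.

rewrite -integral_nneseries//; last first.
  move=> k l /=; rewrite in_itv/= andbT => l0.
  by rewrite lee_fin mulr_ge0 ?exprn_ge0 ?f0.
transitivity (\int[leb]_(l in `]0%R, +oo[%classic)
    ((mu^-1 / b)%:E * (exponential_pdf b l)%:E))%E.
  apply: eq_integral => l; rewrite inE/= in_itv/= andbT => l0.
  under eq_eseriesr do rewrite -mulrA EFinM.
  rewrite nneseriesZl; last first.
    move=> k _; rewrite lee_fin mulr_ge0 ?exprn_ge0// poisson_weight_ge0//.
    by rewrite mulr_ge0// ltW.
  rewrite nneseries_poisson_weight//; last by rewrite mulr_ge0// ltW.
  rewrite -!EFinM; congr EFin.
  rewrite (exponential_pdfE _ (ltW l0)) (exponential_pdfE _ (ltW l0)).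
  rewrite [RHS]mulrA divfK ?gt_eqF//.
  rewrite -[LHS]mulrA -expRD.
  by congr (_ * expR _); rewrite /b; ring.
rewrite ge0_integralZl//; last 3 first.
- by apply/measurable_EFinP/measurable_funTS; exact: measurable_exponential_pdf.
- by move=> l _; rewrite lee_fin exponential_pdf_ge0// ltW.
- by rewrite lee_fin divr_ge0// ?invr_ge0 ltW.
rewrite integral_exponential_pdf_gt0// mule1; congr EFin.
rewrite -invfM; congr (_^-1); rewrite /b; field.
by rewrite gt_eqF.
Qed.
End geometric_law.

(** * Law of a Poisson process at an independent random time *)

Section subordinated_poisson.
Context d (T : measurableType d) (R : realType) (P : probability T R).
Variables (lambda : R) (N : R -> {RV P >-> nat}) (Z : {RV P >-> R}).
Hypothesis lambda0 : 0 < lambda.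
Hypothesis Z0 : forall w, 0 <= Z w.
Hypothesis Ncadlag : forall w, cadlag_path (fun t => (N t w)%:R : R).
Hypothesis Nlaw : forall s m, 0 < s ->
  P [set w | N s w = m] = (poisson_weight (lambda * s) m)%:E.
Hypothesis NZ : forall s m (B : set R), 0 <= s -> measurable B ->
  P ([set w | N s w = m] `&` Z @^-1` B) =
  (P [set w | N s w = m] * P (Z @^-1` B))%E.

(* Approximates [Z] strictly from above, so that right-continuity applies. *)
Let Zn n w : R := (Num.truncn (n.+1%:R * Z w)).+1%:R / n.+1%:R.

Let Zn_gt n w : Z w < Zn n w.
Proof. by rewrite /Zn ltr_pdivlMr// mulrC truncnS_gt. Qed.

Let Zn_le n w : Zn n w <= Z w + n.+1%:R^-1.
Proof.
rewrite /Zn ler_pdivrMr// mulrDl mulVf// mulrC -natr1 lerD2r.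
by rewrite truncn_le ?mulr_ge0.
Qed.

Let cvg_Zn w : Zn n w @[n --> \oo] --> Z w.
Proof.
apply: (@squeeze_cvgr _ _ _ _ (fun=> Z w) (fun n => Z w + n.+1%:R^-1)).
- by apply: nearW => n; rewrite (ltW (Zn_gt _ _)) Zn_le.
- exact: cvg_cst.
- rewrite -[X in _ --> X]addr0.
  by apply: cvgD; [exact: cvg_cst|exact: cvg_harmonic].
Qed.

(** The event on which [Zn n] takes the constant value [j.+1 / n.+1]. *)
Let F n j := Z @^-1` `[j%:R / n.+1%:R, j.+1%:R / n.+1%:R[.

Let FP n j w : F n j w <-> Num.truncn (n.+1%:R * Z w) = j.
Proof.
rewrite /F/= in_itv/= ler_pdivrMr// ltr_pdivlMr// mulrC.
by split => [/truncn_def//|<-]; rewrite truncn_itv// mulr_ge0.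
Qed.

Let mF n j : measurable (F n j).
Proof. exact: measurable_funPTI. Qed.

Let bigcupF n : \bigcup_j F n j = setT.
Proof. by apply/seteqP; split => // w _; eexists => //; apply/FP. Qed.

Let trivF n : trivIset setT (F n).
Proof. by move=> i j _ _ [w [/FP <- /FP <-]]. Qed.

Let A n m := [set w | N (Zn n w) w = m].

Let AE n m : A n m =
  \bigcup_j (F n j `&` [set w | N (j.+1%:R / n.+1%:R) w = m]).
Proof.
apply/seteqP; split => w.
  by move=> Aw; exists (Num.truncn (n.+1%:R * Z w)) => //; split => //; apply/FP.
by move=> [j _ [/FP <-]].
Qed.

Let mN s m : measurable [set w | N s w = m].
Proof. exact: (measurable_funPTI (N s) (Y := [set m])). Qed.

Let mA n m : measurable (A n m).
Proof. by rewrite AE; apply: bigcup_measurable => j _; exact: measurableI. Qed.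

Let mpw m (V : T -> R) : measurable_fun setT V ->
  measurable_fun setT (fun w => poisson_weight (lambda * V w) m).
Proof.
move=> mV; apply: (measurableT_comp (measurable_poisson_weight m)).
exact: measurable_funM.
Qed.

Let mZn n : measurable_fun setT (Zn n).
Proof.
rewrite -(bigcupF n); apply/measurable_fun_bigcup => // j.
have : measurable_fun (F n j) (cst (j.+1%:R / n.+1%:R : R)).
  exact: measurable_cst.
apply: eq_measurable_fun => w; rewrite inE => /FP jw.
by rewrite /Zn jw.
Qed.

(** On each [F n j] the random time is deterministic and positive, so [NZ] and [Nlaw] apply there;
    summing over [j] rebuilds the integral. *)
Let PA n m : P (A n m) = (\int[P]_w (poisson_weight (lambda * Zn n w) m)%:E)%E.
Proof.
have trivFN : trivIset setT
    (fun j => F n j `&` [set w | N (j.+1%:R / n.+1%:R) w = m]).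
  exact: trivIset_setIr.
rewrite AE measure_bigcup//; last by move=> j _; exact: measurableI.
rewrite -(bigcupF n) ge0_integral_bigcup//; last first.
- move=> w _; rewrite lee_fin poisson_weight_ge0// mulr_ge0 ?(ltW lambda0)//.
  by rewrite (le_trans (Z0 w))// ltW.
- by apply/measurable_EFinP/measurable_funTS/mpw.
rewrite eseries_mkcond; apply: eq_eseriesr => j _; rewrite in_setT.
rewrite (eq_integral (cst (poisson_weight (lambda * (j.+1%:R / n.+1%:R)) m)%:E)).
  rewrite integral_cst// [F n j `&` _]setIC -Nlaw//; exact: NZ.
by move=> w; rewrite inE => /FP jw; rewrite /Zn jw.
Qed.

Let A_infty m := [set w | N (Z w) w = m].

(** Since [Zn n w] decreases to within any distance of [Z w] while staying above it,
    right-continuity gives convergence of the counts. *)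
Let cvg_A m w : \1_(A n m) w @[n --> \oo] --> (\1_(A_infty m) w : R).
Proof.
have [Nr _] := Ncadlag w.
have /cvg_at_rightP := Nr _ (Z0 w).
move=> /(_ (Zn ^~ w)) => h.
have {}h : (N (Zn n w) w)%:R @[n --> \oo] --> ((N (Z w) w)%:R : R).
  by apply: h; split.
apply: cvg_near_cst; move/cvgrPdist_lt : h => /(_ 1 ltr01); apply: filterS => n.
(* Integers at distance less than 1 coincide, so the counts, and with them the indicators, are
   eventually constant in [n]. *)
have natr_dist (a b : nat) : `|a%:R - b%:R : R| < 1 -> a = b.
  rewrite ltr_norml => /andP[ab ba]; apply/eqP.
  rewrite eqn_leq -(ltnS a) -(ltnS b) -!(ltr_nat R) -!natr1.
  by apply/andP; split; lra.
move=> /natr_dist ZE.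
have AP : A_infty m w <-> A n m w by split => <-.
rewrite !indicE; congr (nat_of_bool _)%:R.
by apply/idP/idP => /set_mem/AP/mem_set.
Qed.

(** [N] is only given as measurable at each fixed time; measurability at the random time comes from
    the limit of the indicators of [A n m]. *)
Lemma measurable_subordinated m : measurable [set w | N (Z w) w = m].
Proof.
apply/(@measurable_indicP _ _ R).
apply: (@measurable_fun_cvg _ _ _ _ (fun n => \1_(A n m))) => [n|w _].
  exact: measurable_indic.
exact: cvg_A.
Qed.

(** Pass to the limit on both sides of [PA] by bounded convergence: indicators on the left,
    continuity of the Poisson weight on the right. *)
Lemma subordinated_law m : P [set w | N (Z w) w = m] =
  (\int[P]_w (poisson_weight (lambda * Z w) m)%:E)%E.
Proof.
have h1 : P (A n m) @[n --> \oo] --> P [set w | N (Z w) w = m].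
  have := @bounded_convergence _ _ _ P setT
    (fun n => \1_(A n m)) (\1_(A_infty m)) 1.
  rewrite integral_indic//; last exact: measurable_subordinated.
  under eq_fun do rewrite integral_indic// setIT.
  rewrite setIT; apply => //.
  - by move=> n w _; rewrite indicE; case: (_ \in _); rewrite ?normr1 ?normr0.
apply: (cvg_unique _ h1) => //.
have -> : (fun n => P (A n m)) =
    (fun n => \int[P]_w (poisson_weight (lambda * Zn n w) m)%:E)%E.
  by apply/funext => n; exact: PA.
apply: (@bounded_convergence _ _ _ P setT _ _ 1) => //.
- move=> n; apply: mpw; exact: mZn.
- move=> w _; have cZ : lambda * Zn n w @[n --> \oo] --> lambda * Z w.
    by apply: cvgMl_tmp; exact: cvg_Zn.
  exact: (cvg_comp _ _ cZ (@continuous_poisson_weight R m _)).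
- move=> n w _; have ? : 0 <= lambda * Zn n w.
    by rewrite mulr_ge0 ?(ltW lambda0)// (le_trans (Z0 w))// ltW.
  by rewrite ger0_norm ?poisson_weight_ge0 ?poisson_weight_le1.
Qed.
End subordinated_poisson.

(** * Independence of partial sums from later jumps *)

Section independent_sums.
Context d (T : measurableType d) (R : realType) (P : probability T R).

(** Both sides are measures in [A] that agree on rectangles. The event [E] is carried along so that
    the independence of sums can be proved by induction. *)
Lemma pair_law (V W : {RV P >-> R}) (E : set T) : measurable E ->
  (forall B C, measurable B -> measurable C ->
    P (V @^-1` B `&` W @^-1` C `&` E) = P (V @^-1` B) * P (W @^-1` C) * P E)%E ->
  forall A, measurable A ->
    P ([set w | A (V w, W w)] `&` E) =
    ((distribution P V \x distribution P W) A * P E)%E.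
Proof.
move=> mE indep A mA.
have mVW : measurable_fun setT (fun w => (V w, W w)) by exact: measurable_fun_pair.
pose VW : {mfun T >-> (R * R)%type} :=
  HB.pack (fun w => (V w, W w)) (isMeasurableFun.Build _ _ _ _ _ mVW).
have PE0 : 0 <= fine (P E) by rewrite fine_ge0.
pose c : {nonneg R} := NngNum PE0.
have cE : (c%:num%:E)%E = P E by rewrite /= fineK// fin_num_measure.
(* The factor [P E] is put on the second marginal, so that both measures are compared with one
   product measure. *)
pose mW := mscale c (distribution P W).
have e1 := @product_measure_unique _ _ _ _ R (distribution P V) mW
  (pushforward (mrestr P mE) VW).
have e2 := @product_measure_unique _ _ _ _ R (distribution P V) mW
  (mscale c (distribution P V \x distribution P W)%E).
rewrite -[LHS]/(pushforward (mrestr P mE) VW A) -e1//; last first.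
  move=> B C mB mC.
  by rewrite /pushforward /mrestr/= /mW /mscale cE muleCA muleC -indep.
rewrite e2//; first by rewrite /mscale [LHS]muleC; congr (_ * _)%E; exact: cE.
move=> B C mB mC; rewrite /mW /mscale muleCA; congr (_ * _)%E.
exact: product_measure1E.
Qed.

Variable X : nat -> {RV P >-> R}.

Definition partial_sum (m : nat) (w : T) : R := \sum_(i < m) X i w.

Lemma measurable_partial_sum m : measurable_fun setT (partial_sum m).
Proof. exact: measurable_sum. Qed.

HB.instance Definition _ m :=
  isMeasurableFun.Build _ _ _ _ (partial_sum m) (measurable_partial_sum m).

Let cylinder (s : seq nat) (B : nat -> set R) : set T :=
  [set w | forall i, i \in s -> B i (X i w)].

Let cylinder_cons j s B :
  cylinder (j :: s) B = X j @^-1` B j `&` cylinder s B.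
Proof.
apply/seteqP; split => w.
  by move=> Bw; split => [|i si]; apply: Bw; rewrite inE ?eqxx ?si ?orbT.
by move=> [Bj Bw] i; rewrite inE => /orP[/eqP ->//|]; exact: Bw.
Qed.

Let measurable_cylinder s B : (forall i, i \in s -> measurable (B i)) ->
  measurable (cylinder s B).
Proof.
elim: s => [_|j s ih mB].
  rewrite (_ : cylinder _ _ = setT)//.
  by apply/seteqP; split.
rewrite cylinder_cons; apply: measurableI.
  by apply: measurable_funPTI; apply: mB; rewrite mem_head.
by apply: ih => i si; apply: mB; rewrite inE si orbT.
Qed.

Hypothesis indepX : mutually_independent P X.

Let cylinder_law j s B : uniq (j :: s) ->
  (forall i, i \in j :: s -> measurable (B i)) ->
  (P (cylinder (j :: s) B) = P (X j @^-1` B j) * P (cylinder s B))%E.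
Proof.
move=> us mB; rewrite /cylinder !indepX ?big_cons//.
- by case/andP: us.
- by move=> i si; apply: mB; rewrite inE si orbT.
Qed.

(** Induction on [m]. Applied to the indices [m :: s], the induction hypothesis makes
    [partial_sum m], [X m] and the later jumps factor; [pair_law] then treats the sum of the first
    two. *)
Lemma partial_sum_independent m s (B : set R) (C : nat -> set R) :
  uniq s -> (forall i, i \in s -> (m <= i)%N) -> measurable B ->
  (forall i, i \in s -> measurable (C i)) ->
  (P (partial_sum m @^-1` B `&` [set w | forall i, i \in s -> C i (X i w)]) =
   P (partial_sum m @^-1` B) * P [set w | forall i, i \in s -> C i (X i w)])%E.
Proof.
elim: m s B C => [|m ih] s B C us ms mB mC; rewrite -/(cylinder s C).
  have [B0|B0] := pselect (B 0).
    rewrite (_ : partial_sum 0 @^-1` B = setT) ?setTI ?probability_setT ?mul1e//.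
    by apply/seteqP; split => // w _; rewrite /partial_sum/= big_ord0.
  rewrite (_ : partial_sum 0 @^-1` B = set0) ?set0I ?measure0 ?mul0e//.
  by apply/seteqP; split => // w; rewrite /partial_sum/= big_ord0.
pose A := (fun x : R * R => x.1 + x.2) @^-1` B.
have mA : measurable A.
  rewrite -[A]setTI; apply: measurable_funD => //.
have SA : partial_sum m.+1 @^-1` B = [set w | A (X m w, partial_sum m w)].
  by apply/seteqP; split => w; rewrite /A/= /partial_sum big_ord_recr/= addrC.
(* Used twice: with [r = s], and with [r] empty to recognise the law of [partial_sum m.+1]. *)
have law r : uniq r -> (forall i, i \in r -> (m < i)%N) ->
    (forall i, i \in r -> measurable (C i)) ->
    (P ([set w | A (X m w, partial_sum m w)] `&` cylinder r C) =
     (distribution P (X m) \x distribution P (partial_sum m)) A *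
     P (cylinder r C))%E.
  move=> ur mr mC'; apply: pair_law => //; first exact: measurable_cylinder.
  (* [C'] adds the constraint [D] on [X m] and leaves the others unchanged, since [m] is not in
     [r]. *)
  move=> D D' mD mD'; pose C' i := if i == m then D else C i.
  have rC' i : i \in r -> C' i = C i.
    by move=> ir; rewrite /C' ifN// gtn_eqF ?mr.
  have -> : cylinder r C = cylinder r C'.
    apply/seteqP; split => w Cw i ir; first by rewrite rC'//; exact: Cw.
    by rewrite -rC'//; exact: Cw.
  have umr : uniq (m :: r).
    by rewrite /= ur andbT; apply/negP => /mr; rewrite ltnn.
  have mC'' i : i \in m :: r -> measurable (C' i).
    rewrite inE /C'; case: eqP => //= _; exact: mC'.
  have := ih (m :: r) D' C' umr _ mD' mC''.
  rewrite -/(cylinder (m :: r) C') cylinder_law// cylinder_cons.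
  have -> : C' m = D by rewrite /C' eqxx.
  rewrite [X m @^-1` D `&` (_ @^-1` D')]setIC -setIA => ->.
    by rewrite muleCA muleA.
  by move=> i; rewrite inE => /orP[/eqP ->//|/mr/ltnW].
rewrite SA law//; congr (_ * _)%E.
have := law [::] isT (fun i => _) (fun i => _).
have -> : cylinder [::] C = setT by apply/seteqP; split.
by rewrite setIT probability_setT mule1 => ->.
Qed.

(** * Distribution functions of the partial sums *)

Variable F : cumulativeBounded (0 : R) (1 : R).
Hypothesis cdfX : forall i y, cdf (X i) y = (F y)%:E.

(* The same function as [X i], with the Borel sets presented as on the domain
   of [lebesgue_stieltjes_measure]. *)
Let borelX i : T -> measurableTypeR R := X i.

Let measurable_borelX i : measurable_fun setT (borelX i).
Proof. exact: (measurable_funPT (X i)). Qed.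

HB.instance Definition _ i :=
  isMeasurableFun.Build _ _ _ _ (borelX i) (measurable_borelX i).

(** It suffices to compare the two measures on the intervals []a, b]], where both give [F b - F a]
    if [a <= b]. *)
Let distribution_stieltjes i A : measurable A ->
  lebesgue_stieltjes_measure F A = distribution P (borelX i) A.
Proof.
move=> mA; apply: lebesgue_stieltjes_measure_unique => // _ [[a b]] _ <-.
rewrite /lebesgue_stieltjes_measure /measure_extension/=.
rewrite measurable_mu_extE/=; last exact: is_ocitv.
have [ab|ba] := leP a b; last first.
  by rewrite set_itv_ge ?wlength0 ?measure0// bnd_simp -leNgt ltW.
rewrite wlength_itv_bnd// EFinB -!(cdfX i).
have -> : `]a, b]%classic = `]-oo, b] `\` `]-oo, a] :> set R.
  by rewrite -[RHS]setCK setCD setCitvl setUC -[LHS]setCK setCitv.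
rewrite measureD ?setIidr//; first exact: subset_itvl.
by rewrite -ge0_fin_numE// fin_num_measure.
Qed.

(** Condition on the last jump: given [X m = x], the first [m] jumps must sum to at most [y - x].
    Integrating over the law of [X m] is one more convolution with [F]. *)
Lemma partial_sum_cdf m y :
  P [set w | partial_sum m w <= y] = (convolution_power F m y)%:E.
Proof.
elim: m y => [|m ih] y.
  rewrite /convolution_power/=.
  rewrite (_ : [set _ | _] = if 0 <= y then setT else set0).
    by case: ifPn => _; rewrite ?probability_setT ?measure0.
  by apply/seteqP; split => w /=; rewrite /partial_sum big_ord0; case: ifPn.
pose A := [set z : R * R | z.1 + z.2 <= y].
have mA : measurable A.
  have -> : A = setT `&` (fun z : R * R => z.1 + z.2) @^-1` `]-oo, y].
    by rewrite setTI; apply/seteqP; split => z; rewrite /A/= in_itv.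
  exact: measurable_funD.
have Fge0 z : 0 <= convolution_power F m z by rewrite -lee_fin -ih.
(* Measurability of the integrand is obtained alongside, as it comes from the same sections of
   [A]. *)
have lawE : P [set w | partial_sum m.+1 w <= y] =
    (\int[P]_w (convolution_power F m (y - X m w))%:E)%E /\
    measurable_fun [set: R] (fun x => (convolution_power F m (y - x))%:E).
  have -> : [set w | partial_sum m.+1 w <= y] =
      [set w | A (X m w, partial_sum m w)].
    by apply/seteqP; split => w; rewrite /A/= /partial_sum big_ord_recr/= addrC.
  rewrite -[X in P X]setIT pair_law//; last first.
    move=> B C mB mC; rewrite setIT probability_setT mule1.
    have := @partial_sum_independent m [:: m] C (fun=> B) isT.
    rewrite (_ : [set w | forall i, _] = X m @^-1` B); last first.
      apply/seteqP; split => w Bw; first by apply: Bw; rewrite mem_head.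
      by move=> i; rewrite inE => /eqP ->.
    rewrite setIC muleC; apply => // i; by rewrite inE => /eqP ->.
  have FE x : distribution P (partial_sum m) (xsection A x) =
      (convolution_power F m (y - x))%:E.
    rewrite -ih; congr (P _); apply/seteqP; split => w;
    by rewrite /xsection/= inE/= lerBrDl.
  have mF : measurable_fun [set: R]
      (fun x => (convolution_power F m (y - x))%:E).
    under eq_fun do rewrite -FE.
    exact: measurable_fun_xsection.
  rewrite probability_setT mule1 /product_measure1; split => //.
  under eq_integral do rewrite /= FE.
  by rewrite ge0_integral_distribution// => x; rewrite lee_fin.
have [{}lawE mF] := lawE.
rewrite /convolution_power iterS -/(convolution_power F m).
rewrite /stieltjes_convolution /Rintegral.
rewrite (eq_measure_integral (distribution P (borelX m))); last first.
  by move=> B mB _; exact: distribution_stieltjes.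
rewrite ge0_integral_distribution//=; last by move=> x; rewrite lee_fin.
rewrite fineK -lawE// fin_num_measure//.
rewrite (_ : [set w | _] = partial_sum m.+1 @^-1` `]-oo, y]).
  exact: measurable_funPTI.
by apply/seteqP; split => w; rewrite /= in_itv.
Qed.

End independent_sums.

(** * Conditioning on an independent integer-valued index *)

Section random_index.
Context d (T : measurableType d) (R : realType) (P : probability T R).

Lemma probability_random_index (K : T -> nat) (A : nat -> set T) :
  (forall k, measurable [set w | K w = k]) -> (forall k, measurable (A k)) ->
  (forall k, P ([set w | K w = k] `&` A k) = P [set w | K w = k] * P (A k))%E ->
  (P [set w | A (K w) w] = \sum_(k <oo) P [set w | K w = k] * P (A k))%E.
Proof.
move=> mK mA indep.
have -> : [set w | A (K w) w] = \bigcup_k ([set w | K w = k] `&` A k).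
  apply/seteqP; split => w; first by move=> Aw; exists (K w).
  by move=> [k _ [<-]].
rewrite measure_bigcup//.
- rewrite eseries_mkcond; apply: eq_eseriesr => k _.
  by rewrite in_setT; exact: indep.
- by move=> k _; exact: measurableI.
- by move=> i j _ _ [w [[<- _] [<- _]]].
Qed.

Lemma process_sigma_preimage I d' (U : measurableType d') (J : set I)
    (Z : I -> T -> U) i (B : set U) :
  J i -> measurable B -> process_sigma J Z (Z i @^-1` B).
Proof.
move=> Ji mB; apply: sub_sigma_algebra; exists i => //.
by exists B => //; rewrite setTI.
Qed.

(** With [T] carrying the sigma-algebra generated by the jumps, each [X i] is measurable, hence so
    is a finite sum. *)
Lemma process_sigma_partial_sum (X : nat -> {RV P >-> R}) m (B : set R) :
  measurable B -> process_sigma setT X (partial_sum X m @^-1` B).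
Proof.
move=> mB.
pose G := \bigcup_(i in setT) preimage_set_system setT (X i) measurable.
have mX i : measurable_fun (T := g_sigma_algebraType G) setT (X i).
  move=> _ C mC; rewrite setTI.
  exact: (@process_sigma_preimage _ _ _ setT (fun i => X i : T -> R)).
have := @measurable_sum _ (g_sigma_algebraType G) R setT _ (index_enum 'I_m) _
  (fun i : 'I_m => mX i).
by move=> /(_ measurableT B mB); rewrite setTI.
Qed.

Variables (X : nat -> {RV P >-> R}) (F : cumulativeBounded (0 : R) (1 : R)).
Hypothesis indepX : mutually_independent P X.
Hypothesis cdfX : forall i y, cdf (X i) y = (F y)%:E.

Lemma measurable_partial_sum_le m (y : R) :
  measurable [set w | partial_sum X m w <= y].
Proof.
rewrite (_ : [set w | _] = partial_sum X m @^-1` `]-oo, y]).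
  exact: measurable_funPTI.
by apply/seteqP; split => w; rewrite /= in_itv.
Qed.

Lemma measurable_compound_le (K : R -> T -> nat) (s y : R) :
  (forall m, measurable [set w | K s w = m]) ->
  measurable [set w | compound K X s w <= y].
Proof.
move=> mK.
have -> : [set w | compound K X s w <= y] =
    \bigcup_m ([set w | K s w = m] `&` [set w | partial_sum X m w <= y]).
  apply/seteqP; split => w; first by move=> Yw; exists (K s w).
  by move=> [k _ [<-]].
apply: bigcup_measurable => m _; apply: measurableI => //.
exact: measurable_partial_sum_le.
Qed.

(** Given [m] jumps, the compound sum is [partial_sum m], whose distribution function is the
    [m]-fold convolution. *)
Lemma compound_law (K : R -> T -> nat) (s y : R) : 0 <= s ->
  independent_processes P setT X nonneg_times K ->
  (forall m, measurable [set w | K s w = m]) ->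
  (P [set w | (compound K X s w <= y)%R] =
   \sum_(m <oo) P [set w | K s w = m] * (convolution_power F m y)%:E)%E.
Proof.
move=> s0 indepK mK.
have := @probability_random_index (K s)
  (fun m => [set w | partial_sum X m w <= y]) mK
  (fun m => measurable_partial_sum_le m y).
rewrite -[X in P X]/[set w | compound K X s w <= y] => ->.
  by apply: eq_eseriesr => m _; rewrite (partial_sum_cdf indepX cdfX).
move=> m; rewrite setIC muleC.
apply: indepK.
  rewrite (_ : [set w | _] = partial_sum X m @^-1` `]-oo, y]).
    exact: process_sigma_partial_sum.
  by apply/seteqP; split => w; rewrite /= in_itv.
exact: (@process_sigma_preimage _ _ _ nonneg_times K s [set m]).
Qed.

End random_index.

(** * Mixing the laws of the clock and differentiating the transform *)

Section mixture.
Context d (T : measurableType d) (R : realType) (P : probability T R).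
Variables (pr : nat -> {nonneg R}) (Z : nat -> {RV P >-> R}).
Hypothesis Z0 : forall k w, 0 <= Z k w.
Hypothesis pr1 : (\sum_(k <oo) (pr k)%:num%:E = 1)%E.
Local Notation I := (`[0%R, +oo[%classic : set R).

(** The law of [Z K] for an index [K] independent of the [Z k] and distributed according to [pr]. *)
Let mix : set R -> \bar R :=
  mseries (fun k => mscale (pr k) (distribution P (Z k))) 0.

HB.instance Definition _ := Measure.on mix.

Let mixT : mix setT = 1%E.
Proof.
rewrite -pr1; apply: eq_eseriesr => k _.
rewrite -[RHS]mule1; congr (_ * _)%E.
exact: (probability_setT (distribution P (Z k))).
Qed.

Let mix_fin : fin_num_fun mix.
Proof.
move=> A mA; rewrite ge0_fin_numE//.
have mA1 : (mix A <= mix setT)%E by apply: le_measure; rewrite ?inE.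
by apply: le_lt_trans mA1 _; rewrite mixT ltry.
Qed.

HB.instance Definition _ := Measure_isFinite.Build _ _ _ mix mix_fin.

Lemma mixture_law : exists rho : {finite_measure set R -> \bar R},
  forall h : R -> \bar R, measurable_fun setT h ->
  (forall z, (0 <= z)%R -> 0 <= h z)%E ->
  (\int[rho]_(z in I) h z =
   \sum_(k <oo) (pr k)%:num%:E * \int[P]_w h (Z k w))%E.
Proof.
exists mix => h mh h0.
have hI z : I z -> (0 <= h z)%E by rewrite /= in_itv/= andbT; exact: h0.
have mhI : measurable_fun I h by exact: measurable_funTS.
rewrite ge0_integral_measure_series//.
apply: eq_eseriesr => k _; rewrite ge0_integral_mscale//; congr (_ * _)%E.
rewrite ge0_integral_pushforward//; last by move=> z; rewrite inE; exact: hI.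
rewrite (_ : Z k @^-1` I = setT)//.
by apply/seteqP; split => w _ //; rewrite /= in_itv/= andbT.
Qed.

(** The hypothesis says that [g u] is the Laplace transform of the mixture at [lambda * u]. Its
    expansion in powers of [1 - u] has the mixed Poisson probabilities as coefficients, and these
    are read off from the derivatives at 1. *)
Lemma mixed_poisson_derivatives (lambda : R) (g : R -> R) : 0 <= lambda ->
  (forall s : R, (`|s| < 1)%R -> \sum_(k <oo) (pr k)%:num%:E *
      \int[P]_w (expR (- (lambda * Z k w * (1 - s))))%:E = (g (1 - s)%R)%:E)%E ->
  exists p : R^nat,
  [/\ forall m, ((p m)%:E = \sum_(k <oo) (pr k)%:num%:E *
        \int[P]_w (poisson_weight (lambda * Z k w) m)%:E)%E,
      forall m, derive1n m g 1 = (-1) ^+ m * (m`!%:R * p m) &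
      forall m, \forall u \near (1 : R), derivable (derive1n m g) u 1].
Proof.
move=> l0 gE; have [rho rhoE] := mixture_law.
have mw m : measurable_fun [set: R] (fun z => poisson_weight (lambda * z) m).
  apply: (measurableT_comp (measurable_poisson_weight m)).
  exact: measurable_funM.
pose p m := (\int[rho]_(z in I) poisson_weight (lambda * z) m)%R.
have pE m : ((p m)%:E = \sum_(k <oo) (pr k)%:num%:E *
    \int[P]_w (poisson_weight (lambda * Z k w) m)%:E)%E.
  rewrite -(rhoE (fun z => (poisson_weight (lambda * z) m)%:E)).
  - rewrite fineK//; apply: integrable_fin_num => //.
    apply: (@integrable_bounded _ rho _ 1) => // z z0.
    by rewrite ger0_norm ?poisson_weight_le1 ?poisson_weight_ge0// mulr_ge0.
  - exact/measurable_EFinP.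
  - by move=> z z0; rewrite lee_fin poisson_weight_ge0// mulr_ge0.
have cvgp x : `|x| < 1 -> pseries p x @ \oo --> g (1 - x).
  move=> x1; have := @laplace_pseries _ rho lambda x l0 (ltW x1).
  rewrite /Rintegral (rhoE (fun z => (expR (- (lambda * z * (1 - x))))%:E)) ?gE//.
  - apply/measurable_EFinP; apply: measurableT_comp => //.
    by apply: measurable_funN; apply: measurable_funM => //; exact: measurable_funM.
have gp (u : R) : `|1 - u| < 1 -> g u = limn (pseries p (1 - u)).
  by move=> u1; rewrite (cvg_lim _ (cvgp _ u1))// opprB addrC subrK.
have dp m := derive1n_pseries m (fun x x1 => cvgP _ (cvgp x x1)) gp.
exists p; split => // m.
(* At [u = 1] only the constant coefficient of the differentiated series survives, namely
   [m! * p m]. *)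
- have [|-> _] := dp m 1; first by rewrite subrr normr0.
  rewrite subrr pseries0; congr (_ * _).
  by have := @iter_pseries_diffsE _ p m 0; rewrite add0n mulr1.
- have : (fun v : R => `|1 - v|) x @[x --> (1 : R)] --> `|1 - 1 : R|.
    by apply: cvg_norm; apply: cvgB => //; exact: cvg_cst.
  rewrite subrr normr0 => /cvgr_lt/(_ _ ltr01); apply: filterS => u u1.
  by have [] := dp m u u1.
Qed.
End mixture.

(** * Distribution function of the geometric subordinated compound Poisson process *)

Theorem proposition4p4 (R : realType) (d : measure_display)
    (T : measurableType d) (P : probability T R)
    (b : R) (nu : {measure set R -> \bar R}) (lambda mu : R)
    (F : cumulativeBounded (0 : R) (1 : R))
    (D : R -> {RV P >-> R}) (N G : R -> {RV P >-> nat})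
    (X : nat -> {RV P >-> R})
    (f := bernstein b nu)
    (Nf := subordinated N D)
    (Yf := compound Nf X)
    (Ymu := time_changed Yf G) :
  0 <= b -> levy_measure_pos nu -> nu `]0, +oo[%classic = +oo%E ->
  0 < lambda -> 0 < mu ->
  levy_subordinator P f D ->
  poisson_process P lambda N ->
  independent_processes P nonneg_times N nonneg_times D ->
  mutually_independent P X ->
  (forall i y, cdf (X i) y = (F y)%:E) ->
  independent_processes P setT X nonneg_times Nf ->
  geometric_counting_process P mu G ->
  independent_processes P nonneg_times G nonneg_times Yf ->
  forall y t : R, 0 < t ->
  let g := fun u : R => (1 + mu * t * (1 - expR (- f (lambda * u))))^-1 in
  let a := fun m : nat =>
    (-1) ^+ m / m`!%:R * convolution_power F m y * derive1n m g 1 in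
  [/\ forall m, \forall u \near (1 : R), derivable (derive1n m g) u 1,
      cvgn (fun n => \sum_(1 <= m < n) a m) &
      P [set w | Ymu t w <= y] =
      ((1 + mu * t * (1 - expR (- f lambda)))^-1 * (0 <= y)%R%:R
       + limn (fun n => \sum_(1 <= m < n) a m))%:E].
Proof.
move=> _ _ _ lambda0 mu0 subD poisN indND indX cdfX indXN geoG indGY y t t0 g a.
have [levyD ndD lapD] := subD.
have [[N0 _ cadN] _ incN] := poisN.
have D0 s w : 0 <= s -> 0 <= D s w.
  by move=> s0; rewrite -[leLHS](levy_start levyD w) ndD.
have lawN s m : 0 < s ->
    P [set w | N s w = m] = (poisson_weight (lambda * s) m)%:E.
  move=> s0; rewrite -poisson_pmfE ?mulr_gt0// -[s in lambda * s]subr0 -incN//.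
  by congr (P _); apply/seteqP; split => w /=; rewrite N0.
have indD k s m (B : set R) : 0 <= s -> measurable B ->
    (P ([set w | N s w = m] `&` D k%:R @^-1` B) =
     P [set w | N s w = m] * P (D k%:R @^-1` B))%E.
  move=> s0 mB; apply: indND.
    exact: (@process_sigma_preimage _ _ _ _ _ nonneg_times N s [set m] s0).
  exact: (@process_sigma_preimage _ _ _ _ _ nonneg_times D k%:R B (ler0n R k)).
have lawNf k m : P [set w | Nf k%:R w = m] =
    (\int[P]_w (poisson_weight (lambda * D k%:R w) m)%:E)%E.
  by apply: (subordinated_law lambda0 (fun w => D0 k%:R w _) cadN lawN (indD k)).
have mNf k m : measurable [set w | Nf k%:R w = m].
  exact: (measurable_subordinated (fun w => D0 k%:R w (ler0n _ _)) cadN m).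
have mG k : measurable [set w | G t w = k].
  exact: (measurable_funPTI (G t) (Y := [set k])).
have pr0 k : 0 <= fine (P [set w | G t w = k]) by rewrite fine_ge0.
pose pr k : {nonneg R} := NngNum (pr0 k).
have prE k : ((pr k)%:num%:E = P [set w | G t w = k])%E.
  by rewrite /= fineK// fin_num_measure.
have pgf := geometric_pgf geoG mu0 t0.
(* The weights sum to the generating function of [G t] at 1. *)
have pr1 : (\sum_(k <oo) (pr k)%:num%:E = 1)%E.
  have := pgf 1; rewrite ler01 lexx => /(_ isT).
  rewrite subrr mulr0 addr0 invr1 => <-; apply: eq_eseriesr => k _.
  by rewrite expr1n mule1 prE.
have gE s : `|s| < 1 -> (\sum_(k <oo) (pr k)%:num%:E *
    \int[P]_w (expR (- (lambda * D k%:R w * (1 - s))))%:E = (g (1 - s)%R)%:E)%E.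
  move=> s1; have ls0 : 0 <= lambda * (1 - s).
    by rewrite mulr_ge0 ?(ltW lambda0)// subr_ge0 (le_trans (ler_norm _))// ltW.
  pose q := expR (- f (lambda * (1 - s))).
  have Ek k : (\int[P]_w (expR (- (lambda * D k%:R w * (1 - s))))%:E =
      (q ^+ k)%:E)%E.
    rewrite -expRM_natl mulrN -lapD// unlock; apply: eq_integral => w _.
    by rewrite mulrAC.
  (* By [Ek] at [k = 1], [q] is the expectation of a variable bounded by 1. *)
  have q01 : 0 <= q <= 1.
    rewrite expR_ge0/= -lee_fin -[q]expr1 -Ek -(probability_setT P).
    rewrite -[leRHS]mul1e -integral_cst//; apply: ge0_le_integral => //.
    - apply/measurable_EFinP; apply: measurableT_comp => //.
      by apply: measurable_funN; apply: measurable_funM => //; exact: measurable_funM.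
    - move=> w _; rewrite lee_fin -[leRHS]expR0 ler_expR oppr_le0 mulrAC.
      by rewrite mulr_ge0// D0.
  rewrite -pgf//; apply: eq_eseriesr => k _; by rewrite prE Ek.
have [p [pE gD gder]] := mixed_poisson_derivatives
  (fun k w => D0 k%:R w (ler0n _ _)) pr1 (ltW lambda0) gE.
(* The sign and the factorial of the derivative cancel those in [a], leaving the probability of [m]
   jumps times the conditional distribution function. *)
have aE m : a m = p m * convolution_power F m y.
  have SS : (-1) ^+ m * (-1) ^+ m = 1 :> R.
    by rewrite -exprMn mulrNN mulr1 expr1n.
  have fact0 : m`!%:R != 0 :> R by rewrite pnatr_eq0 -lt0n fact_gt0.
  rewrite /a gD; set S := (-1) ^+ m in SS *; set q := m`!%:R in fact0 *.
  transitivity ((S * S) * (q^-1 * q) * (p m * convolution_power F m y)).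
    by ring.
  by rewrite SS mulVf// !mul1r.
have F0 m : 0 <= convolution_power F m y.
  by rewrite -lee_fin -(partial_sum_cdf indX cdfX).
(* Condition on [G t = k], then on the number [m] of jumps. Non-negativity allows the sums to be
   exchanged, and the sum over [k] is then [p m]. *)
have lawY : (P [set w | (Ymu t w <= y)%R] =
    \sum_(m <oo) (p m * convolution_power F m y)%:E)%E.
  have := @probability_random_index _ _ _ P (G t)
    (fun k => [set w | Yf k%:R w <= y]) mG _ _.
  move=> ->; last 2 first.
  - by move=> k; apply: measurable_compound_le.
  - move=> k; apply: indGY.
      exact: (@process_sigma_preimage _ _ _ _ _ nonneg_times G t [set k]
        (ltW t0)).
    rewrite (_ : [set w | _] = Yf k%:R @^-1` `]-oo, y]); last first.
      by apply/seteqP; split => w; rewrite /= in_itv.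
    exact: (@process_sigma_preimage _ _ _ _ _ nonneg_times Yf k%:R _
      (ler0n R k)).
  transitivity (\sum_(k <oo) \sum_(m <oo) (pr k)%:num%:E *
      P [set w | Nf k%:R w = m] * (convolution_power F m y)%:E)%E.
    apply: eq_eseriesr => k _; rewrite (compound_law indX cdfX)//.
    rewrite -prE -nneseriesZl//; last by move=> m _; rewrite mule_ge0 ?lee_fin.
    by apply: eq_eseriesr => m _; rewrite muleA.
  rewrite nneseries_interchange; last first.
    by move=> k m; rewrite !mule_ge0 ?lee_fin ?F0 ?pr0.
  apply: eq_eseriesr => m _; rewrite EFinM pE [RHS]muleC -nneseriesZl; last first.
    move=> k _; apply: mule_ge0; first by rewrite lee_fin pr0.
    by rewrite -lawNf; exact: measure_ge0.
  by apply: eq_eseriesr => k _; rewrite lawNf muleC.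
have p0 m : 0 <= p m.
  rewrite -lee_fin pE; apply: nneseries_ge0 => k _ _; apply: mule_ge0.
    by rewrite lee_fin pr0.
  by rewrite -lawNf; exact: measure_ge0.
have mY : measurable [set w | Ymu t w <= y].
  have -> : [set w | Ymu t w <= y] =
      \bigcup_k ([set w | G t w = k] `&` [set w | Yf k%:R w <= y]).
    apply/seteqP; split => w; first by move=> Yw; exists (G t w).
    by move=> [k _ [<-]].
  apply: bigcup_measurable => k _; apply: measurableI => //.
  exact: measurable_compound_le.
have Pfin : P [set w | Ymu t w <= y] \is a fin_num by rewrite fin_num_measure.
have cvga : series a @ \oo --> fine (P [set w | Ymu t w <= y]).
  have -> : series a =
      fine \o (fun n => \sum_(0 <= m < n) (p m * convolution_power F m y)%:E)%E.
    by apply/funext => n; rewrite /= sumEFin; apply: eq_bigr => m _; rewrite aE.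
  apply: fine_cvg; rewrite fineK// lawY.
  by apply: is_cvg_nneseries => m _ _; rewrite lee_fin mulr_ge0.
(* The stated series starts at 1, so the term [a 0], which is [g 1] times the indicator of [0 <= y],
   is split off. *)
have cvga1 : \sum_(1 <= m < n) a m @[n --> \oo] -->
    fine (P [set w | Ymu t w <= y]) - a 0%N.
  rewrite -cvg_shiftS/= (_ : (fun n => _) = fun n => series a n.+1 - a 0%N).
    by apply: cvgB; [rewrite cvg_shiftS|exact: cvg_cst].
  by apply/funext => n; rewrite /series/= [in RHS]big_ltn// addrAC subrr add0r.
split; [exact: gder|exact: cvgP cvga1|].
rewrite (cvg_lim _ cvga1)// -[LHS]fineK//; congr EFin.
have -> : (1 + mu * t * (1 - expR (- f lambda)))^-1 * (0 <= y)%R%:R = a 0%N.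
  by rewrite /a expr0 fact0 divr1 mul1r mulrC /= /g mulr1.
by rewrite addrC subrK.
Qed.
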